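(* Let $N$ be any positive number and let $p$ be any positive integer or $p=\infty$. Let $P_{\mathbf A}(z)=I z^m+A_{m-1}z^{m-1}+\cdots+A_1z+A_0$ and $P_{\bar{\mathbf A}}(z)=I z^m+\bar A_{m-1}z^{m-1}+\cdots+\bar A_1z+\bar A_0$, with $A_i,\bar A_i\in\mathbb C^{n\times n}$, be monic matrix polynomials such that $|\mathbf A|_p\le N$ and $|\bar{\mathbf A}|_p\le N$. Then there exists a constant $c$ such that $$\mathrm{dist}(\sigma(\mathbf A),\sigma(\bar{\mathbf A}))\le c\,\|\mathbf A-\bar{\mathbf A}\|_p^{\frac1{mn}} .$$
   Context: $m,n\ge1$ are integers and $I$ is the $n\times n$ identity matrix. $\mathbf A=(A_0,\dots,A_{m-1},A_m)$ and $\bar{\mathbf A}=(\bar A_0,\dots,\bar A_{m-1},\bar A_m)$ with $A_m=\bar A_m=I$ are the coefficient tuples. For a matrix $X=(x_{ij})$, the matrix $p$-norm is $|X|_p=(\sum_{i,j}|x_{ij}|^p)^{1/p}$ for $1\le p<\infty$ and $|X|_\infty=\max_{i,j}|x_{ij}|$; for a tuple, $|\mathbf A|_p=\big(\sum_{i=0}^m|A_i|_p^p\big)^{1/p}$ for $p<\infty$ and $|\mathbf A|_\infty=\max_{0\le i\le m}|A_i|_\infty$. For a (possibly rectangular) matrix $X$, $\|X\|_p=\max\{|Xv|_p:|v|_p=1\}$ is the operator norm induced by the vector $p$-norms. The norm $\|\mathbf A-\bar{\mathbf A}\|_p$ is the operator $p$-norm of the block row matrix $[A_0-\bar A_0\;\cdots\;A_{m-1}-\bar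 A_{m-1}\;\;0]\in\mathbb C^{n\times(m+1)n}$. $\sigma(\mathbf A)$ is the spectrum of $P_{\mathbf A}$: the $mn$ roots $\alpha_1,\dots,\alpha_{mn}$ of $\det P_{\mathbf A}(z)$, listed with multiplicity; similarly $\sigma(\bar{\mathbf A})=\{\bar\alpha_1,\dots,\bar\alpha_{mn}\}$. The optimal matching distance is $\mathrm{dist}(\sigma(\mathbf A),\sigma(\bar{\mathbf A}))=\min_\theta\max_j|\alpha_j-\bar\alpha_{\theta(j)}|$, the minimum being over permutations $\theta$ of $\{1,\dots,mn\}$. *)

(* Defs.v *)
From HB Require Import structures.
From mathcomp Require Import all_boot all_order all_algebra all_fingroup.
From mathcomp Require Import all_classical all_reals exp.
From mathcomp Require Import zify.
From mathcomp Require Export complex.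

Set Implicit Arguments.
Unset Strict Implicit.
Unset Printing Implicit Defensive.
Import Order.TTheory GRing.Theory Num.Theory.
Local Open Scope ring_scope.
Local Open Scope complex_scope.

Section Norms.
Variable R : realType.

(* The modulus as an element of R: on R[i] the generic norm `|z| is itself an
   element of R[i], with zero imaginary part. *)
Definition cmod (z : R[i]) : R := complex.Re `|z|.

(* The l^p norm of a finite family of nonnegative reals, for an exponent in
   [1, +oo]. The value at -oo is junk. *)
Definition lpnorm (p : \bar R) (I : finType) (a : I -> R) : R :=
  match p with
  | r%:E => (\sum_i a i `^ r) `^ r^-1
  | +oo%E => \big[Num.max/0]_i a i
  | -oo%E => 0
  end.

(* The entrywise norm |X|_p; on column vectors it is the vector p-norm. *)
Definition mxpnorm (p : \bar R) (k l : nat) (X : 'M[R[i]]_(k, l)) : R :=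
  lpnorm p (fun ij : 'I_k * 'I_l => cmod (X ij.1 ij.2)).

Definition tuplepnorm (p : \bar R) (m n : nat) (A : 'I_m.+1 -> 'M[R[i]]_n) : R :=
  lpnorm p (fun i => mxpnorm p (A i)).

(* The induced norm ||X||_p. The supremum is a maximum, by compactness of the
   unit sphere of C^l (which is nonempty for 0 < l). *)
Definition opnorm (p : \bar R) (k l : nat) (X : 'M[R[i]]_(k, l)) : R :=
  sup [set mxpnorm p (X *m v) | v in [set v : 'cV[R[i]]_l | mxpnorm p v = 1]]%classic.

(* || A - B ||_p, for the block row [A_0 - B_0 ... A_m - B_m]; the last block
   vanishes when A_m = B_m = I. *)
Definition tuple_opdist (p : \bar R) (m n : nat)
    (A B : 'I_m.+1 -> 'M[R[i]]_n) : R :=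
  opnorm p (\mxrow_(i < m.+1) (A i - B i)).

End Norms.

Section Spectrum.
Variables (R : realType) (m n : nat).
Implicit Type A : 'I_m.+1 -> 'M[R[i]]_n.

Definition matpoly A : 'M[{poly R[i]}]_n :=
  \sum_(i < m.+1) 'X^i *: map_mx polyC (A i).

(* The roots of det P_A, listed with multiplicity (in an unspecified order). *)
Definition spectrum A : seq R[i] :=
  sval (closed_field_poly_normal (\det (matpoly A))).

Lemma matpolyE A i j : matpoly A i j = \sum_(k < m.+1) A k i j *: 'X^k.
Proof.
by rewrite summxE; apply: eq_bigr => k _; rewrite !mxE mulrC mul_polyC.
Qed.

Lemma size_matpoly A i j : A ord_max = 1%:M ->
  (size (matpoly A i j) <= m + (i == j))%N.
Proof.
move=> Am; rewrite matpolyE big_ord_recr /= Am mxE.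
have Hs : (size (\sum_(k < m) A (widen_ord (leqnSn m) k) i j *: 'X^k)%R
           <= m)%N.
  apply: leq_trans (size_sum _ _ _) _; apply/bigmax_leqP => k _.
  by apply: leq_trans (size_scale_leq _ _) _; rewrite size_polyXn.
case: (i == j); last by rewrite scale0r addr0 addn0.
rewrite scale1r addn1; apply: leq_trans (size_polyD _ _) _.
by rewrite size_polyXn geq_max leqnn andbT; apply: leq_trans Hs _.
Qed.

Lemma matpoly_diag A i : A ord_max = 1%:M ->
  (matpoly A i i \is monic) && (size (matpoly A i i) == m.+1).
Proof.
move=> Am; have Hs := size_matpoly i i Am.
have Hc : (matpoly A i i)`_m = 1.
  rewrite matpolyE coef_sum (bigD1 ord_max) //= coefZ coefXn eqxx Am mxE eqxx.
  rewrite mulr1 big1 ?addr0 // => k; rewrite -val_eqE /= => kn.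
  by rewrite coefZ coefXn eq_sym (negPf kn) mulr0.
have Hz : size (matpoly A i i) = m.+1.
  apply/eqP; rewrite eqn_leq; move: Hs; rewrite eqxx addn1 => -> /=.
  by rewrite ltnNge; apply/negP => /(nth_default 0) h; move/eqP: (oner_neq0 R[i]); rewrite -Hc h.
by rewrite monicE lead_coefE Hz /= Hc !eqxx.
Qed.

Lemma det_matpoly A : A ord_max = 1%:M ->
  (\det (matpoly A) \is monic) && (size (\det (matpoly A)) == (m * n).+1).
Proof.
move=> Am; rewrite /determinant (bigD1 1%g) //= odd_perm1 expr0 mul1r.
under eq_bigr do rewrite perm1.
set d := \prod_i _; set q := \sum_(s | _) _.
have md : d \is monic.
  by apply: monic_prod => i _; case/andP: (matpoly_diag i Am).
have sd : size d = (m * n).+1.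
  rewrite size_prod; last first.
    by move=> i _; apply: monic_neq0; case/andP: (matpoly_diag i Am).
  under eq_bigr do rewrite (eqP (andP (matpoly_diag _ Am)).2).
  by rewrite sum_nat_const card_ord mulnS mulnC subSn ?leq_addr // addKn.
have sq : (size q <= m * n)%N.
  apply: leq_trans (size_sum _ _ _) _; apply/bigmax_leqP => s ns.
  have [i0 hi0] : exists i, s i != i.
    apply/existsP; rewrite -negb_forall; apply: contra ns => s1.
    by apply/eqP/permP => i; apply/eqP; rewrite perm1 (forallP s1).
  rewrite size_Msign; apply: leq_trans (size_poly_prod_leq _ _) _.
  rewrite (bigD1 i0) //= card_ord leq_subLR.
  have h0 := size_matpoly i0 (s i0) Am.
  rewrite eq_sym (negPf hi0) addn0 in h0.
  have h1 : (\sum_(i < n | i != i0) size (matpoly A i (s i)) <= n.-1 * m.+1)%N.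
    have -> : (n.-1 * m.+1 = \sum_(i < n | i != i0) m.+1)%N.
      by rewrite sum_nat_const cardC1 card_ord.
    apply: leq_sum => i _; apply: leq_trans (size_matpoly _ _ Am) _.
    by case: (_ == _); rewrite ?addn1 ?addn0.
  have n0 : (0 < n)%N by apply: leq_trans (ltn_ord i0).
  apply: (@leq_ltn_trans (m + n.-1 * m.+1)); first exact: leq_add.
  by rewrite -(prednK n0) /= !mulnS [in X in (X < _)%N]mulnC; lia.
have lt : (size q < size d)%N by rewrite sd.
by rewrite monicE lead_coefDl // size_polyDl // sd eqxx -monicE md.
Qed.

Lemma size_spectrum A : A ord_max = 1%:M -> size (spectrum A) = (m * n)%N.
Proof.
move=> Am; have /andP[mD /eqP sD] := det_matpoly Am.
rewrite /spectrum; case: closed_field_poly_normal => s /= Ds.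
rewrite Ds (monicP mD) scale1r size_prod_XsubC in sD.
by case: sD.
Qed.

End Spectrum.

(* The optimal matching distance of two lists of length k. *)
Definition matching_dist (R : realType) (k : nat) (a b : seq R[i]) : R :=
  let cost (theta : 'S_k) :=
    \big[Num.max/0]_(j < k) cmod (a`_j - b`_(theta j)) in
  \big[Num.min/cost 1%g]_(theta : 'S_k) cost theta.

(* Main.v *)
(* Boundedness of the coefficients makes [det P_A] a monic polynomial with
   coefficients bounded in terms of [N] and Lipschitz in [||A - B||_p], so the
   claim reduces to monic [f], [g] of degree [d] with
   [||f - g|| <= C delta]. At a root of [f + t (g - f)], [0 <= t <= 1], [|f|] is
   [O(delta)], so this root lies within [r = O(delta^(1/d))] of a root of [f].
   Following the roots as [t] goes from 0 to 1, each one stays in one connected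
   component of a union of [d] discs of radius [O(r)], so that its endpoints, a
   root of [f] and a root of [g], are at distance [O(d r)]. *)
Require Import Defs.
From mathcomp Require Import all_boot all_order all_algebra all_fingroup.
From mathcomp Require Import all_classical all_reals exp.
From mathcomp Require Import zify ring lra.

Import Order.TTheory GRing.Theory Num.Theory.
Local Open Scope ring_scope.
Local Open Scope complex_scope.

(** * Real-valued modulus on the complex numbers *)

Section Modulus.
Context {R : realType}.
Implicit Types x y z : R[i].

Lemma norm_cmod z : `|z| = (cmod z)%:C.
Proof. by rewrite /cmod normc_def. Qed.

Lemma cmod_ge0 z : 0 <= cmod z.
Proof. by rewrite -lecR -norm_cmod normr_ge0. Qed.

Lemma cmod0 : cmod (0 : R[i]) = 0.
Proof. by rewrite /cmod normr0. Qed.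

Lemma cmod1 : cmod (1 : R[i]) = 1.
Proof. by rewrite /cmod normr1. Qed.

Lemma cmodN z : cmod (- z) = cmod z.
Proof. by rewrite /cmod normrN. Qed.

Lemma cmod_sub x y : cmod (x - y) = cmod (y - x).
Proof. by rewrite -cmodN opprB. Qed.

Lemma cmodD x y : cmod (x + y) <= cmod x + cmod y.
Proof. by rewrite -lecR rmorphD /= -!norm_cmod ler_normD. Qed.

Lemma cmod_triangle y x z : cmod (x - z) <= cmod (x - y) + cmod (y - z).
Proof. by apply: le_trans (cmodD _ _); rewrite subrKA. Qed.

Lemma cmodM x y : cmod (x * y) = cmod x * cmod y.
Proof. by apply: complexI; rewrite rmorphM /= -!norm_cmod normrM. Qed.

Lemma cmodX x n : cmod (x ^+ n) = cmod x ^+ n.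
Proof. by elim: n => [|n IH]; rewrite ?expr0 ?cmod1 // !exprS cmodM IH. Qed.

Lemma cmod_real (t : R) : 0 <= t -> cmod t%:C = t.
Proof. by move=> t0; rewrite /cmod ger0_norm // lecR. Qed.

Lemma cmod_prod (I : Type) (s : seq I) (F : I -> R[i]) :
  cmod (\prod_(i <- s) F i) = \prod_(i <- s) cmod (F i).
Proof. exact: (big_morph _ cmodM cmod1). Qed.

Lemma cmod_sum (I : Type) (s : seq I) (P : pred I) (F : I -> R[i]) :
  cmod (\sum_(i <- s | P i) F i) <= \sum_(i <- s | P i) cmod (F i).
Proof.
elim/big_rec2: _ => [|i u v _ le_uv]; first by rewrite cmod0.
by apply: le_trans (cmodD _ _) _; rewrite lerD2l.
Qed.

End Modulus.

(** * Coefficient norm of polynomials, root bounds and deflation *)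

Section PolyNorm.
Context {R : realType}.
Implicit Types p q : {poly R[i]}.

(** The l^1 norm of the coefficients; it is submultiplicative, which suits the products in a
    determinant. *)
Definition polynorm p : R := \sum_(i < size p) cmod p`_i.

Lemma polynormE n p : (size p <= n)%N -> polynorm p = \sum_(i < n) cmod p`_i.
Proof.
move=> /subnKC <-; rewrite /polynorm big_split_ord /=.
rewrite [X in _ + X]big1 ?addr0 //.
by move=> i _; rewrite nth_default ?cmod0 // leq_addr.
Qed.

Lemma polynorm_ge0 p : 0 <= polynorm p.
Proof. by apply: sumr_ge0 => i _; apply: cmod_ge0. Qed.

Lemma cmod_coef_le p i : cmod p`_i <= polynorm p.
Proof.
have [lt_ip|le_pi] := ltnP i (size p); last first.
  by rewrite nth_default // cmod0 polynorm_ge0.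
rewrite /polynorm (bigD1 (Ordinal lt_ip)) //= lerDl.
by apply: sumr_ge0 => j _; apply: cmod_ge0.
Qed.

Lemma polynorm0 : polynorm 0 = 0.
Proof. by rewrite /polynorm size_poly0 big_ord0. Qed.

Lemma polynorm1 : polynorm 1 = 1.
Proof. by rewrite /polynorm size_poly1 big_ord1 coef1 cmod1. Qed.

Lemma polynormD p q : polynorm (p + q) <= polynorm p + polynorm q.
Proof.
set n := maxn (size p) (size q).
rewrite (polynormE n (p + q)) ?size_polyD //.
rewrite (polynormE n p) ?leq_maxl // (polynormE n q) ?leq_maxr //.
by rewrite -big_split /=; apply: ler_sum => i _; rewrite coefD cmodD.
Qed.

Lemma polynormN p : polynorm (- p) = polynorm p.
Proof.
by rewrite /polynorm size_polyN; apply: eq_bigr => i _; rewrite coefN cmodN.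
Qed.

Lemma polynormB p q : polynorm (p - q) = polynorm (q - p).
Proof. by rewrite -polynormN opprB. Qed.

Lemma polynormZ c p : polynorm (c *: p) = cmod c * polynorm p.
Proof.
rewrite (polynormE (size p)) ?size_scale_leq // mulr_sumr.
by apply: eq_bigr => i _; rewrite coefZ cmodM.
Qed.

Lemma polynorm_sum (I : Type) (s : seq I) (P : pred I) (F : I -> {poly R[i]}) :
  polynorm (\sum_(i <- s | P i) F i) <= \sum_(i <- s | P i) polynorm (F i).
Proof.
elim/big_rec2: _ => [|i u v _ le_uv]; first by rewrite polynorm0.
by apply: le_trans (polynormD _ _) _; rewrite lerD2l.
Qed.

Lemma polynormXnM k p : polynorm ('X^k * p) = polynorm p.
Proof.
rewrite (polynormE (k + size p)); last first.
  by rewrite (leq_trans (size_polyMleq _ _)) // size_polyXn.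
rewrite big_split_ord /= big1 ?add0r; last first.
  by move=> i _; rewrite coefXnM ltn_ord cmod0.
by apply: eq_bigr => i _; rewrite coefXnM ltnNge leq_addr addKn.
Qed.

(** Expanding [p] into monomials leaves multiplications by ['X^k], which only shift coefficients. *)
Lemma polynormM p q : polynorm (p * q) <= polynorm p * polynorm q.
Proof.
rewrite -{1}(coefK p) poly_def mulr_suml.
apply: le_trans (polynorm_sum _ _ _ _) _; rewrite {2}/polynorm mulr_suml.
by apply: ler_sum => i _; rewrite -scalerAl polynormZ polynormXnM.
Qed.

Lemma cmod_horner_le n p z (M : R) : 1 <= M -> cmod z <= M ->
  (size p <= n.+1)%N -> cmod p.[z] <= polynorm p * M ^+ n.
Proof.
move=> M1 zM sp; rewrite horner_coef (polynormE _ _ (leqnn _)) mulr_suml.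
apply: le_trans (cmod_sum _ _ _ _) _; apply: ler_sum => i _.
rewrite cmodM cmodX ler_wpM2l ?cmod_ge0 //.
apply: (@le_trans _ _ (M ^+ i)).
  by rewrite lerXn2r ?nnegrE ?cmod_ge0 //; lra.
by apply: ler_weXn2l => //; move: (ltn_ord i); lia.
Qed.

(** If [cmod z > 1], isolating the leading term bounds [|z|^d] by [polynorm p * |z|^(d-1)], and a
    power of [|z|] cancels. *)
Lemma monic_root_bound p z (M : R) : p \is monic -> 1 <= M ->
  polynorm p <= M -> root p z -> cmod z <= M.
Proof.
move=> mp M1 pM /eqP pz0.
have [z1|z1] := lerP (cmod z) 1; first exact: le_trans z1 M1.
have := monic_neq0 mp; rewrite -size_poly_gt0.
case sp: (size p) => [//|d] _.
have pd : p`_d = 1 by move/monicP: mp; rewrite lead_coefE sp.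
have norm_p : polynorm p = \sum_(i < d) cmod p`_i + 1.
  by rewrite /polynorm sp big_ord_recr /= pd cmod1.
move: pz0; rewrite horner_coef sp big_ord_recr /= pd mul1r => /eqP.
rewrite addr_eq0 => /eqP/(congr1 (@cmod R)); rewrite cmodN => e.
(* In degree 0 the polynomial is the constant 1, and the root equation reads 0 = 1. *)
case: d sp pd norm_p e => [|d] sp pd norm_p e.
  move: e; rewrite big_ord0 expr0 cmod0 cmod1 => /eqP.
  by rewrite eq_sym oner_eq0.
have le1 : cmod z ^+ d.+1 <= polynorm p * cmod z ^+ d.
  rewrite -cmodX -e; apply: le_trans (cmod_sum _ _ _ _) _.
  rewrite norm_p mulrDl mul1r -[X in X <= _]addr0; apply: lerD; last first.
    by rewrite exprn_ge0 ?cmod_ge0.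
  rewrite mulr_suml; apply: ler_sum => i _.
  rewrite cmodM cmodX ler_wpM2l ?cmod_ge0 // ler_weXn2l ?(ltW z1) //.
  by rewrite -ltnS.
apply: le_trans pM; move: le1; rewrite exprS ler_pM2r // exprn_gt0 //.
exact: lt_trans z1.
Qed.

(* Synthetic division by [X - a]: the coefficients of [p] are obtained from
   those of [(X - a) p] by the downward recurrence [p_(i-1) = u_i + a p_i]. *)
Lemma polynorm_deflate n p a (M : R) : 0 <= M -> cmod a <= M ->
  (size p <= n)%N ->
  polynorm p <= n%:R * (1 + M) ^+ n * polynorm (('X - a%:P) * p).
Proof.
move=> M0 aM sp; set u := ('X - a%:P) * p; set U := polynorm u.
have U0 : 0 <= U := polynorm_ge0 _.
have rec i : p`_i = u`_i.+1 + a * p`_i.+1.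
  by rewrite /u mulrBl coefB coefXM coefCM /= subrK.
(* Descent from index [n], where the coefficient vanishes; once [k >= n], truncated subtraction
   keeps the index at 0. *)
have bound k : cmod p`_(n - k) <= U * (1 + M) ^+ k.
  elim: k => [|k IH]; first by rewrite subn0 nth_default // cmod0 mulr_ge0.
  have [le_nk|lt_kn] := leqP n k.
    have -> : (n - k.+1 = n - k)%N by lia.
    apply: le_trans IH _; rewrite ler_wpM2l // ler_weXn2l //; lra.
  rewrite rec; have -> : (n - k.+1).+1 = (n - k)%N by lia.
  apply: le_trans (cmodD _ _) _; rewrite cmodM.
  have leu : cmod u`_(n - k) <= U := cmod_coef_le _ _.
  have P1 : 1 <= (1 + M) ^+ k by rewrite exprn_ege1 //; lra.
  have le2 := ler_pM (cmod_ge0 _) (cmod_ge0 _) aM IH.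
  rewrite exprS; apply: le_trans (lerD leu le2) _.
  have : U <= U * (1 + M) ^+ k by rewrite ler_peMr.
  by rewrite (mulrCA U) mulrDl mul1r; lra.
rewrite (polynormE _ _ sp).
have -> : n%:R * (1 + M) ^+ n * U = \sum_(i < n) U * (1 + M) ^+ n.
  by rewrite sumr_const card_ord -mulrA mulr_natl mulrC.
apply: ler_sum => i _; have -> : (i = n - (n - i) :> nat)%N.
  by move: (ltn_ord i); lia.
apply: le_trans (bound _) _; rewrite ler_wpM2l // ler_weXn2l ?leq_subr //; lra.
Qed.

End PolyNorm.

(** * Matching the roots of two monic polynomials *)

Section RootMatching.
Context {R : realType}.
Implicit Types (a b c : seq R[i]) (p q : {poly R[i]}).

Definition rootpoly a : {poly R[i]} := \prod_(x <- a) ('X - x%:P).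

Lemma polynorm_prod_XsubC a (M : R) : (forall x, x \in a -> cmod x <= M) ->
  polynorm (rootpoly a) <= (1 + M) ^+ size a.
Proof.
rewrite /rootpoly; elim: a => [|x a IH] aM; first by rewrite big_nil polynorm1.
rewrite big_cons exprS; apply: le_trans (polynormM _ _) _.
apply: ler_pM; rewrite ?polynorm_ge0 //; last first.
  by apply: IH => y ya; rewrite aM // inE ya orbT.
rewrite /polynorm size_XsubC big_ord_recr big_ord1 /= !coefB !coefX !coefC /=.
by rewrite sub0r subr0 cmodN cmod1 addrC lerD2l aM ?mem_head.
Qed.

(** The modulus of the value at [z] is the product of the distances from [z] to the entries of [a];
    were all of them above [r], it would exceed [r ^+ size a]. *)
Lemma has_close_root a z (r : R) : 0 <= r -> (0 < size a)%N ->
  cmod (rootpoly a).[z] <= r ^+ size a ->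
  exists2 x, x \in a & cmod (z - x) <= r.
Proof.
move=> r0 a0; rewrite /rootpoly horner_prod cmod_prod => le_r.
apply/hasP; apply: contraTT le_r => /hasPn far; rewrite -ltNge.
elim: a a0 far => [//|x a IH] _ far; rewrite big_cons exprS !hornerE.
have rx : r < cmod (z - x) by rewrite ltNge; apply: far; rewrite mem_head.
case: a IH far => [|y a] IH far; first by rewrite big_nil expr0 !mulr1.
apply: ltr_pM => //; first exact: exprn_ge0.
by apply: IH => // w wa; apply: far; rewrite inE wa orbT.
Qed.

(* Continuity of the roots in its crudest form. Removing one pair of close
   roots at a time loses powers of [eps], so this gives no Hoelder exponent. *)
Lemma root_matching_continuous d (M eta : R) : 1 <= M -> 0 < eta ->
  exists2 eps : R, 0 < eps & forall a b, size a = d -> size b = d ->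
    (forall x, x \in a -> cmod x <= M) -> (forall x, x \in b -> cmod x <= M) ->
    polynorm (rootpoly a - rootpoly b) <= eps ->
  exists2 b', perm_eq b b' & forall i, (i < d)%N -> cmod (a`_i - b'`_i) <= eta.
Proof.
move=> M1 eta0; elim: d => [|d [eps1 eps1_gt0 IH]].
  by exists 1 => // a b _ _ _ _ _; exists b.
have M0 : 0 < M by lra.
have P0 : 0 < (1 + M) ^+ d by rewrite exprn_gt0 //; lra.
(* [T] is the loss factor of [polynorm_deflate]; [x] solves [T * (x + x * (1 + M) ^+ d) = eps1], the
   tolerance for the remaining [d] roots. *)
set T : R := d.+1%:R * (1 + M) ^+ d.+1.
have T0 : 0 < T by rewrite mulr_gt0 ?ltr0n // exprn_gt0 //; lra.
set x := eps1 / (T * (1 + (1 + M) ^+ d)).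
have x0 : 0 < x by rewrite divr_gt0 // mulr_gt0 //; lra.
set eta' := Num.min eta x.
have eta'0 : 0 < eta' by rewrite lt_min eta0.
(* The first bound forces a root of [rootpoly b] within [eta'] of [a0]; the second controls the
   difference after deflation. *)
exists (Num.min (eta' ^+ d.+1 / M ^+ d.+1) x).
  by rewrite lt_min x0 andbT divr_gt0 // exprn_gt0.
move=> [//|a0 a] b /= [sa] sb aM bM; rewrite le_min => /andP[le_eta le_x].
have a0M : cmod a0 <= M by rewrite aM ?mem_head.
have fa0 : (rootpoly (a0 :: a)).[a0] = 0.
  by rewrite /rootpoly big_cons hornerM hornerXsubC subrr mul0r.
have [b0 b0b a0b0] : exists2 y, y \in b & cmod (a0 - y) <= eta'.
  apply: has_close_root; rewrite ?sb ?(ltW eta'0) //.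
  rewrite -cmodN -[- _]add0r -fa0 -hornerN -hornerD.
  apply: (@le_trans _ _ (eta' ^+ d.+1 / M ^+ d.+1 * M ^+ d.+1)); last first.
    by rewrite divfK // gt_eqF // exprn_gt0.
  apply: le_trans (cmod_horner_le d.+1 _ _ _ M1 a0M _) _.
    rewrite (leq_trans (size_polyD _ _)) // size_polyN /rootpoly.
    by rewrite !size_prod_XsubC sb /= sa maxnn.
  by rewrite ler_wpM2r // exprn_ge0 // ltW.
have pb := perm_to_rem b0b; set b1 := rem b0 b in pb.
have sb1 : size b1 = d by rewrite size_rem ?sb.
have a1M z : z \in a -> cmod z <= M by move=> za; rewrite aM // inE za orbT.
have b1M z : z \in b1 -> cmod z <= M.
  by move=> zb; rewrite bM // (perm_mem pb) inE zb orbT.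
have [] := IH a b1 sa sb1 a1M b1M.
  have T1 : polynorm (rootpoly b1) <= (1 + M) ^+ d.
    by rewrite -sb1; apply: polynorm_prod_XsubC.
  apply: le_trans (polynorm_deflate d.+1 _ a0 _ (ltW M0) a0M _) _.
    rewrite (leq_trans (size_polyD _ _)) // size_polyN /rootpoly.
    by rewrite !size_prod_XsubC sb1 sa maxnn.
  (* Trading the factor [X - b0] of [rootpoly b] for [X - a0] costs the last term, small because
     [a0] and [b0] are close. *)
  have -> : ('X - a0%:P) * (rootpoly a - rootpoly b1) =
      (rootpoly (a0 :: a) - rootpoly b) + (a0 - b0) *: rootpoly b1.
    rewrite {4}/rootpoly (perm_big _ pb) /= {3}/rootpoly !big_cons.
    rewrite -!/(rootpoly _) -mul_polyC polyCB; ring.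
  apply: (@le_trans _ _ (T * (x + x * (1 + M) ^+ d))).
    rewrite ler_wpM2l ?(ltW T0) //; apply: le_trans (polynormD _ _) _.
    apply: lerD => //; rewrite polynormZ ler_pM ?cmod_ge0 ?polynorm_ge0 //.
    by apply: le_trans a0b0 _; rewrite ge_min lexx orbT.
  rewrite -[X in X + _]mulr1 -mulrDr mulrCA /x mulfVK // gt_eqF //.
  by rewrite mulr_gt0 //; lra.
move=> b' pb' close; exists (b0 :: b').
  by apply: perm_trans pb _; rewrite perm_cons.
case=> [|i] /=; last by rewrite ltnS; apply: close.
by move=> _; apply: le_trans a0b0 _; rewrite ge_min lexx.
Qed.

Lemma monic_roots_exist p : p \is monic ->
  exists2 c, size c = (size p).-1 & p = rootpoly c.
Proof.
move=> mp; have [c pc] := closed_field_poly_normal p.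
rewrite (monicP mp) scale1r in pc.
by exists c; rewrite // pc size_prod_XsubC.
Qed.

Lemma cmod_path_le a d (r : R) (i : 'I_d) (s : seq 'I_d) :
  path (fun k l : 'I_d => cmod (a`_k - a`_l) <= r) i s ->
  cmod (a`_i - a`_(last i s)) <= (size s)%:R * r.
Proof.
elim: s i => [|k s IH] i /=; first by rewrite subrr cmod0 mul0r.
move=> /andP[ik ps]; apply: le_trans (cmod_triangle a`_k _ _) _.
by rewrite -natr1 mulrDl mul1r addrC lerD ?IH.
Qed.

(** A path can be shortened to one without repeated vertices; it then has fewer than [d] edges, each
    of length at most [r]. *)
Lemma cmod_connect_le a d (r : R) (i k : 'I_d) : 0 <= r ->
  connect (fun k l : 'I_d => cmod (a`_k - a`_l) <= r) i k ->
  cmod (a`_i - a`_k) <= d%:R * r.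
Proof.
move=> r0 /connectP[s ps ->]; case/shortenP: ps => s' ps' us' _.
apply: le_trans (cmod_path_le _ _ _ _ _ ps') _; rewrite ler_wpM2r // ler_nat.
have := max_card (mem (i :: s')).
by rewrite (card_uniqP us') card_ord; apply: ltnW.
Qed.

(* The roots are followed along [t = 0, 1/L, ..., 1], with [L] so large that
   consecutive roots are matched within [r]; each trajectory then stays near one
   component of the graph joining roots of [f] at distance at most [3 r]. *)
Lemma root_matching_dist a b d (M r : R) : size a = d -> size b = d ->
  1 <= M -> 0 < r -> (0 < d)%N ->
  polynorm (rootpoly a) <= M -> polynorm (rootpoly b) <= M ->
  polynorm (rootpoly b - rootpoly a) * M ^+ d <= r ^+ d ->
  exists2 b', perm_eq b b' &
    forall i, (i < d)%N -> cmod (a`_i - b'`_i) <= (3 * d + 1)%:R * r.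
Proof.
move=> sa sb M1 r0 d0 fM gM small.
set f := rootpoly a in fM small; set g := rootpoly b in gM small.
have [eps eps0 W] := root_matching_continuous d M r M1 r0.
set D := polynorm (g - f) in small.
have D0 : 0 <= D := polynorm_ge0 _.
(* [L] steps make each increment [(g - f) / L] of norm at most [eps]. *)
pose L := (Num.Def.archi_bound (D / eps)).+1.
have L0 : 0 < L%:R :> R by rewrite ltr0n.
have LD : L%:R^-1 * D <= eps.
  rewrite mulrC ler_pdivrMr // mulrC -ler_pdivrMr //.
  apply: ltW; apply: lt_le_trans (archi_boundP _) _.
    by rewrite divr_ge0 // ltW.
  by rewrite ler_nat /L leqnSn.
pose t j : R := j%:R / L%:R.
have t_ge0 j : 0 <= t j by rewrite divr_ge0 ?ler0n.
have t_le1 j : (j <= L)%N -> t j <= 1.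
  by move=> jL; rewrite ler_pdivrMr // mul1r ler_nat.
pose h j : {poly R[i]} := f + (t j)%:C *: (g - f).
(* A convex combination of [f] and [g] inherits their bound [M], which then bounds its roots as
   well. *)
have h_norm j : (j <= L)%N -> polynorm (h j) <= M.
  move=> jL; have -> : h j = (1 - t j)%:C *: f + (t j)%:C *: g.
    rewrite /h scalerBr rmorphB /= scalerBl scale1r -!addrA; congr (_ + _).
    by rewrite addrC.
  apply: le_trans (polynormD _ _) _; rewrite !polynormZ.
  have t1 := t_le1 j jL; rewrite !cmod_real ?subr_ge0 //.
  have s0 : 0 <= 1 - t j by lra.
  have := ler_wpM2l (t_ge0 j) gM; have := ler_wpM2l s0 fM.
  lra.
have mon_f : f \is monic by apply: monic_prod_XsubC.
have mon_g : g \is monic by apply: monic_prod_XsubC.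
have size_f : size f = d.+1 by rewrite size_prod_XsubC sa.
have size_g : size g = d.+1 by rewrite size_prod_XsubC sb.
(* The leading terms cancel, so every [h j] is monic of degree [d]. *)
have size_gf : (size (g - f)%R <= d)%N.
  apply/leq_sizeP => k; rewrite leq_eqVlt => /orP[/eqP<-|dk]; rewrite coefB.
    move/monicP: mon_f; move/monicP: mon_g.
    by rewrite !lead_coefE size_f size_g /= => -> ->; rewrite subrr.
  by rewrite !nth_default ?subrr ?size_f ?size_g.
have h_lt j : (size ((t j)%:C *: (g - f))%R < size f)%N.
  by rewrite size_f ltnS (leq_trans (size_scale_leq _ _)).
have mon_h j : h j \is monic by rewrite monicE lead_coefDl //; apply/monicP.
have size_h j : size (h j) = d.+1 by rewrite size_polyDl ?h_lt.
have root_h j c : h j = rootpoly c -> (j <= L)%N ->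
    forall x, x \in c -> cmod x <= M.
  move=> hc jL x xc; apply: (monic_root_bound _ _ _ (mon_h j) M1 (h_norm j jL)).
  by rewrite hc root_prod_XsubC.
(* At a root of [h j], [f] equals [- t j * (g - f)], so [small] bounds its modulus by [r ^+ d]. *)
have near j c x : h j = rootpoly c -> (j <= L)%N -> x \in c ->
    exists k : 'I_d, cmod (x - a`_k) <= r.
  move=> hc jL xc; have xM := root_h j c hc jL x xc.
  have [] := has_close_root a x r (ltW r0); rewrite ?sa //; last first.
    move=> y ya; have iy : (index y a < d)%N by rewrite -sa index_mem.
    by exists (Ordinal iy); rewrite /= nth_index.
  rewrite -/f; apply: le_trans small.
  have /rootP hx : root (h j) x by rewrite hc root_prod_XsubC.
  have -> : f.[x] = - ((t j)%:C * (g - f).[x]).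
    by apply/eqP; rewrite -addr_eq0 -hornerZ -hornerD hx.
  rewrite cmodN cmodM cmod_real //.
  apply: le_trans (ler_piMl (cmod_ge0 _) (t_le1 j jL)) _.
  by apply: cmod_horner_le => //; apply: leq_trans size_gf _.
(* Threshold [3 * r]: from [a_k] to the old root, to the new root, to its nearest [a_l], at most [r]
   each. *)
pose e := fun k l : 'I_d => cmod (a`_k - a`_l) <= 3 * r.
(* Invariant: the [i]-th root of [h j] lies within [r] of the component of [a_i]. *)
have follow j : (j <= L)%N -> forall c, size c = d -> h j = rootpoly c ->
    exists2 c', perm_eq c c' & forall i : 'I_d,
      exists2 k, connect e i k & cmod (c'`_i - a`_k) <= r.
  elim: j => [|j IH] jL c sc hc.
    have h0 : h 0%N = f by rewrite /h /t mul0r scale0r addr0.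
    (* Here [c] lists the roots of [f] in another order, so the two polynomials coincide. *)
    have [] := W a c sa sc; rewrite -/f.
    - exact: (root_h 0%N a h0).
    - exact: (root_h 0%N c hc).
    - by rewrite -hc h0 subrr polynorm0 ltW.
    move=> c' pc close; exists c' => // i; exists i; first exact: connect0.
    by rewrite cmod_sub close.
  have [u0 su0 hu0] := monic_roots_exist _ (mon_h j).
  rewrite size_h /= in su0.
  have [u pu conn] := IH (ltnW jL) u0 su0 hu0.
  have su : size u = d by rewrite -(perm_size pu).
  have hu : h j = rootpoly u by rewrite hu0; apply: perm_big.
  have [] := W u c su sc.
  - exact: root_h hu (ltnW jL).
  - exact: root_h hc jL.
  - rewrite -hu -hc /h opprD addrACA subrr add0r -scalerBl -rmorphB /=.
    rewrite -polynormN -scaleNr -rmorphN /= opprB /t -mulrBl -natrB // subSnn.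
    by rewrite polynormZ cmod_real div1r ?invr_ge0 ?ler0n // -/D LD.
  move=> c' pc close; exists c' => // i; have [k ik uk] := conn i.
  have c'i : c'`_i \in c.
    by rewrite (perm_mem pc) mem_nth // -(perm_size pc) sc.
  have [l cl] := near j.+1 c _ hc jL c'i.
  exists l => //; apply: connect_trans ik (connect1 _); rewrite /e.
  have := close i (ltn_ord i).
  have := cmod_triangle u`_i a`_k a`_l; have := cmod_triangle c'`_i u`_i a`_l.
  by rewrite (cmod_sub a`_k u`_i); lra.
have hL : h L = g by rewrite /h /t divff ?gt_eqF // scale1r addrC subrK.
have [b' pb' conn] := follow L (leqnn _) b sb hL.
(* At most [d * (3 * r)] inside the component, plus [r] to reach the root of [g]. *)
exists b' => // i id; have [k ik bk] := conn (Ordinal id).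
have r3 : 0 <= 3 * r by lra.
have aik := cmod_connect_le a d (3 * r) _ _ r3 ik.
apply: le_trans (cmod_triangle a`_k _ _) _.
rewrite (cmod_sub a`_k) natrD natrM; move: aik bk => /=; lra.
Qed.

End RootMatching.

(** * Entries are dominated by the p-norms and the operator norm *)

Section OperatorNorm.
Context {R : realType} {p : \bar R} (p_gt0 : (0 < p)%E).

Lemma lpnorm_ge0 (I : finType) (a : I -> R) : 0 <= lpnorm p a.
Proof.
case: p p_gt0 => [r||] //= _; first exact: powR_ge0.
exact: bigmax_ge_id.
Qed.

Lemma lpnorm_ge (I : finType) (a : I -> R) i :
  (forall j, 0 <= a j) -> a i <= lpnorm p a.
Proof.
move=> a0; case: p p_gt0 => [r||] //=; last by move=> _; apply: le_bigmax.
rewrite lte_fin => r0.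
rewrite -[X in X <= _]powRr1 // -(divff (lt0r_neq0 r0)) powRrM.
apply: ge0_ler_powR; rewrite ?nnegrE ?invr_ge0 ?powR_ge0 ?(ltW r0) //.
  by apply: sumr_ge0 => j _; apply: powR_ge0.
by rewrite (bigD1 i) //= lerDl; apply: sumr_ge0 => j _; apply: powR_ge0.
Qed.

Lemma ler_lpnorm (I : finType) (a b : I -> R) :
  (forall j, 0 <= a j) -> (forall j, a j <= b j) -> lpnorm p a <= lpnorm p b.
Proof.
move=> a0 ab; case: p p_gt0 => [r|_|]; last by clear ab.
  rewrite lte_fin /= => r0.
  apply: ge0_ler_powR; rewrite ?nnegrE ?invr_ge0 ?(ltW r0) //.
  - by apply: sumr_ge0 => j _; apply: powR_ge0.
  - by apply: sumr_ge0 => j _; apply: powR_ge0.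
  apply: ler_sum => j _.
  by apply: ge0_ler_powR; rewrite ?nnegrE ?(ltW r0) //; apply: le_trans (ab j).
by apply: le_bigmax2 => i _; apply: ab.
Qed.

Lemma lpnorm_indicator (I : finType) (i : I) :
  lpnorm p (fun j => (j == i)%:R) = 1.
Proof.
case: p p_gt0 => [r||] //=; last first.
  move=> _; apply/le_anti/andP; split.
    by apply: bigmax_le => // j _; case: (j == i).
  by apply: le_trans (le_bigmax _ _ i); rewrite eqxx.
rewrite lte_fin => r0; rewrite (bigD1 i) //= eqxx powR1 big1 ?addr0 ?powR1 //.
by move=> j /negPf->; rewrite powR0 // gt_eqF.
Qed.

Lemma cmod_le_mxpnorm k l (X : 'M[R[i]]_(k, l)) i j :
  cmod (X i j) <= mxpnorm p X.
Proof.
by apply: (lpnorm_ge _ (fun ij => cmod (X ij.1 ij.2)) (i, j)) => ij;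
  apply: cmod_ge0.
Qed.

Lemma cmod_le_tuplepnorm m n (A : 'I_m.+1 -> 'M[R[i]]_n) k i j :
  cmod (A k i j) <= tuplepnorm p A.
Proof.
apply: le_trans (cmod_le_mxpnorm _ _ (A k) i j) _.
by apply: (lpnorm_ge _ (fun k => mxpnorm p (A k))) => k'; apply: lpnorm_ge0.
Qed.

Lemma mxpnorm_delta l (j : 'I_l) : mxpnorm p (delta_mx j 0 : 'cV[R[i]]_l) = 1.
Proof.
rewrite -(lpnorm_indicator _ (j, ord0 : 'I_1)); congr lpnorm.
apply/funext => -[i o]; rewrite /= mxE xpair_eqE ord1.
by case: (i == j); rewrite ?cmod1 ?cmod0.
Qed.

(** The entry is a coordinate of the image of a basis vector, which has norm 1. *)
Lemma cmod_le_opnorm k l (X : 'M[R[i]]_(k, l)) i j :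
  cmod (X i j) <= opnorm p X.
Proof.
have -> : X i j = (X *m (delta_mx j 0 : 'cV_l)) i 0 by rewrite -colE mxE.
apply: le_trans (cmod_le_mxpnorm _ _ _ i 0) _.
apply: ub_le_sup; last by exists (delta_mx j 0) => //; apply: mxpnorm_delta.
(* The set is bounded above: coordinates of a unit vector have modulus at most 1, so row sums of
   moduli dominate the image. *)
exists (lpnorm p (fun ij : 'I_k * 'I_1 => \sum_h cmod (X ij.1 h))).
move=> _ [v v1 <-]; apply: ler_lpnorm => -[a o]; first exact: cmod_ge0.
rewrite mxE /=; apply: le_trans (cmod_sum _ _ _ _) _.
apply: ler_sum => h _; rewrite cmodM ler_piMr ?cmod_ge0 //.
by rewrite -v1 cmod_le_mxpnorm.
Qed.

Lemma cmod_le_tuple_opdist m n (A B : 'I_m.+1 -> 'M[R[i]]_n) k i j :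
  cmod (A k i j - B k i j) <= tuple_opdist p A B.
Proof.
have -> : A k i j - B k i j = submxrow (\mxrow_(h < m.+1) (A h - B h)) k i j.
  by rewrite mxrowK !mxE.
by rewrite mxE cmod_le_opnorm.
Qed.

End OperatorNorm.

(** * Size and Lipschitz bounds for determinants of polynomial matrices *)

Section Determinant.
Context {R : realType}.

Lemma polynorm_prod_le (I : Type) (s : seq I) (F : I -> {poly R[i]}) (K : R) :
  (forall i, polynorm (F i) <= K) ->
  polynorm (\prod_(i <- s) F i) <= K ^+ size s.
Proof.
move=> FK; elim: s => [|i s IH]; first by rewrite big_nil polynorm1.
rewrite big_cons exprS; apply: le_trans (polynormM _ _) _.
by rewrite ler_pM ?polynorm_ge0.
Qed.

Lemma polynorm_prodB_le (I : Type) (s : seq I) (F G : I -> {poly R[i]})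
    (K delta : R) : 1 <= K ->
  (forall i, polynorm (F i) <= K) -> (forall i, polynorm (G i) <= K) ->
  (forall i, polynorm (F i - G i) <= delta) ->
  polynorm (\prod_(i <- s) F i - \prod_(i <- s) G i)
    <= (size s)%:R * K ^+ size s * delta.
Proof.
move=> K1 FK GK FG; elim: s => [|i s IH].
  by rewrite !big_nil subrr polynorm0 !mul0r.
rewrite !big_cons /=; set f := \prod_(j <- s) F j in IH *.
set g := \prod_(j <- s) G j in IH *.
(* Telescoping: one factor is exchanged at a time. *)
have -> : F i * f - G i * g = F i * (f - g) + (F i - G i) * g by ring.
have d0 : 0 <= delta := le_trans (polynorm_ge0 _) (FG i).
apply: le_trans (polynormD _ _) _.
have le1 : polynorm (F i * (f - g)) <= K * ((size s)%:R * K ^+ size s * delta).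
  by apply: le_trans (polynormM _ _) _; rewrite ler_pM ?polynorm_ge0.
have le2 : polynorm ((F i - G i) * g) <= delta * K ^+ size s.
  apply: le_trans (polynormM _ _) _.
  by rewrite ler_pM ?polynorm_ge0 // polynorm_prod_le.
have le3 : delta * K ^+ size s <= K * (delta * K ^+ size s).
  by rewrite ler_peMl // mulr_ge0 // exprn_ge0 //; lra.
have -> : (size s).+1%:R * K ^+ (size s).+1 * delta =
    K * ((size s)%:R * K ^+ size s * delta) + K * (delta * K ^+ size s).
  by rewrite -natr1 exprS; ring.
lra.
Qed.

Lemma size_index_enum_ord n : size (index_enum 'I_n) = n.
Proof. by rewrite [index_enum _]unlock -enumT size_enum_ord. Qed.

Lemma polynorm_signM (b : bool) (q : {poly R[i]}) :
  polynorm ((-1) ^+ b * q) = polynorm q.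
Proof. by case: b; rewrite ?expr1 ?mulN1r ?polynormN ?expr0 ?mul1r. Qed.

Lemma polynorm_det_le n (P : 'M[{poly R[i]}]_n) (K : R) :
  (forall i j, polynorm (P i j) <= K) ->
  polynorm (\det P) <= n`!%:R * K ^+ n.
Proof.
move=> PK; apply: le_trans (polynorm_sum _ _ _ _) _.
apply: (@le_trans _ _ (\sum_(s : 'S_n) K ^+ n)); last first.
  by rewrite sumr_const card_Sn mulr_natl.
apply: ler_sum => s _; rewrite polynorm_signM.
have := polynorm_prod_le _ (index_enum 'I_n) (fun i => P i (s i)) K.
by rewrite size_index_enum_ord; apply => i; apply: PK.
Qed.

(** The [n!] products of the two Leibniz expansions are compared one permutation at a time. *)
Lemma polynorm_detB_le n (P Q : 'M[{poly R[i]}]_n) (K delta : R) : 1 <= K ->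
  (forall i j, polynorm (P i j) <= K) -> (forall i j, polynorm (Q i j) <= K) ->
  (forall i j, polynorm (P i j - Q i j) <= delta) ->
  polynorm (\det P - \det Q) <= n`!%:R * (n%:R * K ^+ n * delta).
Proof.
move=> K1 PK QK PQ; rewrite /determinant -sumrB.
apply: le_trans (polynorm_sum _ _ _ _) _.
apply: (@le_trans _ _ (\sum_(s : 'S_n) (n%:R * K ^+ n * delta))); last first.
  by rewrite sumr_const card_Sn -[X in X <= _]mulr_natl.
apply: ler_sum => s _; rewrite -mulrBr polynorm_signM.
have := polynorm_prodB_le _ (index_enum 'I_n) (fun i => P i (s i))
  (fun i => Q i (s i)) K delta K1.
by rewrite size_index_enum_ord; apply=> i; [exact: PK|exact: QK|exact: PQ].
Qed.

Lemma polynorm_monomials_le m (a : 'I_m.+1 -> R[i]) (N : R) :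
  (forall k, cmod (a k) <= N) ->
  polynorm (\sum_(k < m.+1) a k *: 'X^k) <= m.+1%:R * N.
Proof.
move=> aN; apply: le_trans (polynorm_sum _ _ _ _) _.
apply: (@le_trans _ _ (\sum_(k < m.+1) N)); last first.
  by rewrite sumr_const card_ord mulr_natl.
apply: ler_sum => k _.
by rewrite polynormZ -['X^k]mulr1 polynormXnM polynorm1 mulr1.
Qed.

End Determinant.

(** * From root matching to the distance between spectra *)

Lemma matching_dist_le (R : realType) k (a b b' : seq R[i]) (x : R) :
  0 <= x -> size b = k -> perm_eq b b' ->
  (forall i, (i < k)%N -> cmod (a`_i - b'`_i) <= x) ->
  matching_dist k a b <= x.
Proof.
move=> x0 sb; rewrite perm_sym => bb' close.
(* The reordering [b'] comes from a permutation [s], whose cost bounds the minimum. *)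
have /tuple_permP[s b's] : perm_eq b' (Tuple (introT eqP sb)) by [].
apply: le_trans (bigmin_le_cond _ _ (isT : predT s)) _.
apply: bigmax_le => // j _; have := close j (ltn_ord j).
rewrite b's (nth_map j) ?size_enum_ord // nth_ord_enum.
by rewrite (tnth_nth 0).
Qed.

Theorem theorem3p9 (R : realType) (m n : nat) (hm : (0 < m)%N) (hn : (0 < n)%N)
    (N : R) (hN : 0 < N) (p : \bar R)
    (hp : p = +oo%E \/ exists2 k : nat, (0 < k)%N & p = (k%:R)%:E) :
  exists c : R, forall A Abar : 'I_m.+1 -> 'M[R[i]]_n,
    A ord_max = 1%:M -> Abar ord_max = 1%:M ->
    tuplepnorm p A <= N -> tuplepnorm p Abar <= N ->
    matching_dist (m * n) (spectrum A) (spectrum Abar)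
      <= c * tuple_opdist p A Abar `^ ((m * n)%:R)^-1.
Proof.
have p_gt0 : (0 < p)%E.
  by case: hp => [->|[k k0 ->]]; rewrite ?lt0y // lte_fin ltr0n.
set d := (m * n)%N; have d0 : (0 < d)%N by rewrite muln_gt0 hm.
(* [K] bounds the norm of every entry of both matrix polynomials, the added 1 giving [1 <= K]; [M]
   then bounds their determinants. *)
pose K : R := m.+1%:R * N + 1.
have K1 : 1 <= K by rewrite lerDr mulr_ge0 ?ler0n ?ltW.
pose M : R := n`!%:R * K ^+ n.
have M1 : 1 <= M.
  by rewrite -[X in X <= _]mulr1 ler_pM ?exprn_ege1 // ler1n fact_gt0.
(* The Lipschitz constant of the determinant in [delta], times the factor [M ^+ d] from evaluation
   at roots. *)
pose C : R := n`!%:R * (n%:R * K ^+ n * m.+1%:R) * M ^+ d.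
have C0 : 0 <= C.
  rewrite /C; do !apply: mulr_ge0; rewrite ?ler0n // exprn_ge0 //; lra.
pose D : R := (3 * d + 1)%:R.
have D0 : 0 < D by rewrite ltr0n addn1.
exists (D * C `^ (d%:R)^-1) => A B Am Bm AN BN.
set delta := tuple_opdist p A B.
have delta0 : 0 <= delta.
  (* An entry of the block row witnesses that the supremum is nonnegative. *)
  pose i0 : 'I_n := Ordinal hn.
  exact: le_trans (cmod_ge0 _) (cmod_le_tuple_opdist p_gt0 _ _ A B ord0 i0 i0).
have entry_bound (E : 'I_m.+1 -> 'M[R[i]]_n) : tuplepnorm p E <= N ->
    forall i j, polynorm (matpoly E i j) <= K.
  move=> EN i j; rewrite matpolyE; apply: (@le_trans _ _ (m.+1%:R * N)).
    apply: polynorm_monomials_le => k; apply: le_trans EN.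
    exact: cmod_le_tuplepnorm.
  by rewrite /K lerDl.
have entry_dist i j : polynorm (matpoly A i j - matpoly B i j)
    <= m.+1%:R * delta.
  rewrite !matpolyE -sumrB; under eq_bigr do rewrite -scalerBl.
  by apply: polynorm_monomials_le => k; apply: cmod_le_tuple_opdist.
have spectrumE (E : 'I_m.+1 -> 'M[R[i]]_n) : E ord_max = 1%:M ->
    \det (matpoly E) = rootpoly (spectrum E).
  move=> Em; have /andP[mD _] := det_matpoly Em.
  rewrite /spectrum; case: closed_field_poly_normal => s /= {1}->.
  by rewrite (monicP mD) scale1r.
have detA := polynorm_det_le _ _ _ (entry_bound A AN).
have detB := polynorm_det_le _ _ _ (entry_bound B BN).
have detAB := polynorm_detB_le _ _ _ _ _ K1 (entry_bound A AN)
  (entry_bound B BN) entry_dist.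
rewrite !spectrumE // in detA detB detAB.
(* Root matching requires a positive radius but [delta] may be 0, so [r] carries a slack [e / D],
   with [e] arbitrary. *)
apply/ler_addgt0Pr => e e0; set t := C `^ _; set u := delta `^ _.
pose r := t * u + e / D.
have r0 : 0 < r by rewrite ltr_wpDl ?divr_gt0 // mulr_ge0 ?powR_ge0.
have -> : D * t * u + e = D * r.
  by rewrite /r mulrDr mulrA mulrCA divff ?mulr1 // gt_eqF.
have sA := size_spectrum Am; have sB := size_spectrum Bm.
have [] := root_matching_dist _ _ _ M r sA sB M1 r0 d0 detA detB.
  apply: (@le_trans _ _ (C * delta)).
    rewrite polynormB; apply: le_trans (ler_wpM2r _ detAB) _.
      by rewrite exprn_ge0 //; lra.
    by rewrite /C; rewrite le_eqVlt; apply/orP; left; apply/eqP; ring.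
  (* The exponent [1/d] is undone by the [d]-th power, whence
     [C * delta = (t * u) ^+ d <= r ^+ d]. *)
  have powK (x : R) : 0 <= x -> (x `^ (d%:R)^-1) ^+ d = x.
    move=> x0; rewrite -powR_mulrn ?powR_ge0 // -powRrM mulVf ?powRr1 //.
    by rewrite pnatr_eq0 -lt0n.
  rewrite -[X in X <= _](powK _ (mulr_ge0 C0 delta0)) powRM //.
  rewrite lerXn2r ?nnegrE ?mulr_ge0 ?powR_ge0 ?(ltW r0) //.
  by rewrite /r lerDl divr_ge0 // ltW.
move=> b pb close; apply: matching_dist_le sB pb close.
by rewrite mulr_ge0 // ltW.
Qed.
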